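(* Let $\mathbb{K}\in\{\mathbb{R},\mathbb{C}\}$ and $N\ge 1$. (a) Let $M\geq 2N$. Suppose $\Phi=\{\varphi_k\}_{k=1}^{M}$ is a divisible tight frame for $\mathbb{K}^N$, and let $\Phi_1 \subsetneq \Phi$ denote a tight frame for $\mathbb{K}^N$. Then $\Phi_2=\Phi \setminus \Phi_1$ is also a tight frame for $\mathbb{K}^N$. (b) Moreover, given $M\geq N$, every tight frame of $M$ vectors in $\mathbb{K}^N$ is a finite union of prime tight frames.
   Context: A finite collection $\Phi=\{\varphi_i\}_{i=1}^M\subset\mathbb{K}^N$ is a tight frame for $\mathbb{K}^N$ with frame bound $A$ if there is $A>0$ with $\sum_{i=1}^M|\langle x,\varphi_i\rangle|^2=A\|x\|^2$ for all $x\in\mathbb{K}^N$. Frames are regarded as non-ordered collections of vectors with repetition allowed; thus sub-collections correspond to subsets of the index set $\{1,\dots,M\}$, complements correspond to complements of index sets, and unions are unions of collections. A tight frame $\Phi=\{\varphi_i\}_{i=1}^M$ in $\mathbb{K}^N$ is prime if no proper subset (sub-collection) of $\Phi$ is a tight frame for $\mathbb{K}^N$; if it is not prime, it is divisible.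
   Formalization: All frame vectors are assumed nonzero in both (a) and (b): for N=1 and Φ={1,0}, Φ₁={1} is a tight frame but its complement {0} is not, and Φ is not a union of prime tight frames; both parts fail for every tight frame that contains a zero vector. *)

(* Defs.v *)
From HB Require Import structures.
From mathcomp Require Import all_boot all_order all_algebra.
From mathcomp Require Import reals.
From mathcomp Require Import complex.

Set Implicit Arguments.
Unset Strict Implicit.
Unset Printing Implicit Defensive.

Import Order.TTheory GRing.Theory Num.Theory.
Local Open Scope ring_scope.

Variant scalar_kind := RealScalars | ComplexScalars.

Definition scalar_field (R : realType) (k : scalar_kind) : numFieldType :=
  match k with
  | RealScalars => R
  | ComplexScalars => R[i]
  end.

Definition sconj (R : realType) (k : scalar_kind) : scalar_field R k -> scalar_field R k :=
  match k with
  | RealScalars => fun z => z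
  | ComplexScalars => fun z : R[i] => Num.conj z
  end.

Section Frames.
Variables (R : realType) (k : scalar_kind) (N : nat).
Let K := scalar_field R k.

Definition inner (x y : 'cV[K]_N) : K :=
  \sum_(j < N) x j 0 * sconj (y j 0).

Definition sqnorm (x : 'cV[K]_N) : K := \sum_(j < N) `|x j 0| ^+ 2.

(* A frame is an indexed family phi : 'I_M -> K^N, and its sub-collections are
   the index sets B; the whole collection is [set: 'I_M].  Repeated vectors
   carry distinct indices.  The norm `|_| is K-valued, and 0 < A in K forces
   A to be a positive real, also over R[i]. *)
Definition tight_frame (M : nat) (phi : 'I_M -> 'cV[K]_N) (B : {set 'I_M}) :=
  exists2 A : K, 0 < A &
    forall x : 'cV[K]_N,
      \sum_(i in B) `|inner x (phi i)| ^+ 2 = A * sqnorm x.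

Definition prime_frame (M : nat) (phi : 'I_M -> 'cV[K]_N) (B : {set 'I_M}) :=
  tight_frame phi B /\
  forall C : {set 'I_M}, C \proper B -> ~ tight_frame phi C.

Definition divisible_frame (M : nat) (phi : 'I_M -> 'cV[K]_N)
    (B : {set 'I_M}) :=
  tight_frame phi B /\ ~ prime_frame phi B.

End Frames.

(* Main.v *)
Require Import Defs.
From mathcomp Require Import all_boot all_order all_algebra.
From mathcomp Require Import reals.
From mathcomp Require Import boolp complex.

Set Implicit Arguments.
Unset Strict Implicit.
Unset Printing Implicit Defensive.

Import Order.TTheory GRing.Theory Num.Theory.
Local Open Scope ring_scope.

Section TightFrames.
Variables (R : realType) (k : scalar_kind) (N : nat).
Let K := scalar_field R k.

(** Frame sums add over disjoint index sets, so removing a tight [C] from a tight [B] leaves the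
    tight frame identity with constant [A - A']. Only its positivity is at stake, and a nonzero
    leftover vector supplies it ([tight_frame_setD]). Splitting non-prime collections in this way
    terminates, since both pieces are smaller, and ends in prime blocks
    ([tight_frame_prime_partition]). *)

Lemma mul_sconj (z : K) : z * sconj z = `|z| ^+ 2.
Proof.
rewrite /K /sconj in z *; case: k z => z; last by rewrite normCK.
by rewrite -expr2 real_normK ?num_real.
Qed.

Lemma inner_diag (x : 'cV[K]_N) : inner x x = sqnorm x.
Proof. by apply: eq_bigr => j _; rewrite mul_sconj. Qed.

Lemma sqnorm_gt0 (x : 'cV[K]_N) : x != 0 -> 0 < sqnorm x.
Proof.
move=> x0; rewrite lt_def sumr_ge0 ?andbT => [|j _]; last exact: exprn_ge0.
apply: contra x0; rewrite psumr_eq0 => [/allP h|j _]; last exact: exprn_ge0.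
apply/eqP/colP => j; rewrite mxE; apply/eqP.
by have := h j (mem_index_enum _); rewrite sqrf_eq0 normr_eq0.
Qed.

Variables (M : nat) (phi : 'I_M -> 'cV[K]_N).

(** An empty sum is 0, whereas [A * sqnorm x] is positive at a nonzero [x], which exists because [N]
    is positive. This keeps the blocks of the partition nonempty. *)
Lemma tight_frame_nonempty (B : {set 'I_M}) :
  (0 < N)%N -> tight_frame phi B -> B != set0.
Proof.
move=> N0 [A A0 tB]; apply/eqP => B0.
have x0 : const_mx 1 != 0 :> 'cV[K]_N.
  apply/eqP => /colP /(_ (Ordinal N0)); rewrite !mxE => /eqP.
  by rewrite oner_eq0.
have := mulr_gt0 A0 (sqnorm_gt0 x0).
by rewrite -tB B0 big_set0 ltxx.
Qed.

Hypothesis phi_neq0 : forall i, phi i != 0.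

(* The defining sum over [B :\: C] is [(A - A') * sqnorm x]; evaluating it at a
   vector of [B :\: C] shows [A - A' > 0]. *)
Lemma tight_frame_setD (B C : {set 'I_M}) :
  C \proper B -> tight_frame phi B -> tight_frame phi C ->
  tight_frame phi (B :\: C).
Proof.
move=> /properP[CB [i0 i0B i0C]] [A A0 tB] [A' A'0 tC].
have tD x : \sum_(i in B :\: C) `|inner x (phi i)| ^+ 2 = (A - A') * sqnorm x.
  rewrite mulrBl -tB -tC (big_setID (A := B) C) /= (setIidPr CB).
  by rewrite addrC addrK.
exists (A - A') => //.
have phi0 := sqnorm_gt0 (phi_neq0 i0).
rewrite -(pmulr_lgt0 _ phi0) -tD (bigD1 i0) ?inE ?i0B ?i0C //=.
rewrite ltr_wpDr ?sumr_ge0 // => [i _|]; first exact: exprn_ge0.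
by rewrite inner_diag exprn_gt0 // normr_gt0 gt_eqF.
Qed.

Lemma tight_frame_prime_partition (B : {set 'I_M}) :
  (0 < N)%N -> tight_frame phi B ->
  exists P : {set {set 'I_M}},
    partition P B /\ forall C, C \in P -> prime_frame phi C.
Proof.
move=> N0; have [n] := ubnP #|B|; elim: n B => // n IH B ltBn tB.
have [pB|npB] := pselect (prime_frame phi B).
  exists [set B]; split; last by move=> C /set1P ->.
  rewrite /partition /trivIset /cover !big_set1 !eqxx inE eq_sym /=.
  exact: tight_frame_nonempty tB.
have [C CB tC] : exists2 C : {set 'I_M}, C \proper B & tight_frame phi C.
  apply: contrapT => h; apply: npB; split=> // C CB tC; apply: h.
  by exists C.
(* The tight part [C] is nonempty, so its complement in [B] is strictly smaller and the induction
   hypothesis covers both pieces. *)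
have ltDB : (#|B :\: C| < #|B|)%N.
  have := cardsID C B; rewrite (setIidPr (proper_sub CB)) => <-.
  by rewrite -[X in (X < _)%N]add0n ltn_add2r card_gt0 tight_frame_nonempty.
have [||P [partP primeP]] := IH C; rewrite ?(leq_trans (proper_card CB)) //.
have [||Q [partQ primeQ]] := IH (B :\: C).
- exact: leq_trans ltDB _.
- exact: tight_frame_setD.
exists (P :|: Q); split; last by move=> D /setUP[/primeP|/primeQ].
have /and3P[/eqP covP trivP P0] := partP; have /and3P[/eqP covQ trivQ Q0] := partQ.
apply/and3P; split; last by rewrite inE negb_or P0.
- rewrite /cover bigcup_setU -!/(cover _) covP covQ setDE setUIr setUCr setIT.
  exact/eqP/setUidPr/proper_sub.
- apply: trivIsetU => //; rewrite covP covQ -setI_eq0; apply/eqP/setP => i.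
  by rewrite !inE; case: (i \in C).
Qed.

End TightFrames.

(* Zero vectors have to be excluded: in dimension 1 the collection {1, 0} is
   tight and divisible, but {0} is not tight, and 0 lies in no prime tight
   frame.  Since sub-collections are index sets, writing a collection as a union
   of sub-collections means partitioning its index set. *)
Theorem theorem2p3 (R : realType) (k : scalar_kind) (N : nat)
    (hN : (1 <= N)%N) :
  (forall (M : nat) (phi : 'I_M -> 'cV[scalar_field R k]_N) (Phi1 : {set 'I_M}),
     (2 * N <= M)%N ->
     (forall i : 'I_M, phi i != 0) ->
     divisible_frame phi [set: 'I_M] ->
     Phi1 \proper [set: 'I_M] ->
     tight_frame phi Phi1 ->
     tight_frame phi ([set: 'I_M] :\: Phi1))
  /\
  (forall (M : nat) (phi : 'I_M -> 'cV[scalar_field R k]_N),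
     (N <= M)%N ->
     (forall i : 'I_M, phi i != 0) ->
     tight_frame phi [set: 'I_M] ->
     exists P : {set {set 'I_M}},
       partition P [set: 'I_M] /\
       (forall B : {set 'I_M}, B \in P -> prime_frame phi B)).
Proof.
split=> [M phi Phi1 _ phi0 [tT _] | M phi _ phi0 tT].
- by move=> Phi1T; apply: tight_frame_setD.
- exact: tight_frame_prime_partition.
Qed.
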